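(* Let $(p_n)_{n\ge 1}$ be a sequence in $[0,1]$ with $n p_n = o\left( \frac{\log^2 n}{(\log\log n)^3} \right)$ as $n\to\infty$, and let $G \sim G(n,p_n)$. Then, with high probability, there exist distinct vertices $u,v \in V(G)$ such that the $2$-neighborhoods of $u$ and $v$ in $G$ are isomorphic.
   Context: $G(n,p)$ denotes the Erdős–Rényi random graph on vertex set $[n]=\{1,\dots,n\}$ in which each pair of distinct vertices is an edge independently with probability $p$. ''With high probability'' means with probability tending to $1$ as $n\to\infty$. For $r\in\mathbb{N}$, the $r$-neighborhood of a vertex $v$ in a graph $G$ is the subgraph of $G$ induced on all vertices at graph distance at most $r$ from $v$, with the central vertex $v$ identified; the $r$-neighborhoods of $u$ and $v$ are isomorphic if there is a graph isomorphism between them mapping $u$ to $v$. *)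

(* Defs.v *)
(* Library world: Mathematical Components with MathComp-Analysis. *)
From HB Require Import structures.
From mathcomp Require Import all_boot all_order all_algebra.
From mathcomp Require Import all_classical all_reals all_analysis.

Set Implicit Arguments.
Unset Strict Implicit.
Unset Printing Implicit Defensive.

Import Order.TTheory GRing.Theory Num.Theory.
Import numFieldNormedType.Exports.

Local Open Scope ring_scope.

(** A simple graph on [V] is its edge set, a set of two-element subsets. *)
Notation vpair V := {e : {set V} | #|e| == 2%N}.
Notation sgraph V := {set vpair V}.

Section Graph.
Variable V : finType.
Implicit Types (G : sgraph V) (u v w : V) (r : nat).

(** Irreflexive, since [[set u; u]] has one element. *)
Definition adj G : rel V := fun u v => [exists e in G, val e == [set u; v]].

(** Graph distance at most [r]: some walk with at most [r] edges goes from [v]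
    to [w]. *)
Definition dist_le G r v w : bool :=
  [exists k : 'I_r.+1, [exists s : k.-tuple V,
     path (adj G) v s && (last v s == w)]].

Definition ball G r v : {set V} := [set w | dist_le G r v w].

Lemma ball_center G r v : v \in ball G r v.
Proof.
by rewrite inE; apply/existsP; exists ord0; apply/existsP; exists [tuple] => /=.
Qed.

Definition nbhd_vertex G r v := {w : V | w \in ball G r v}.

Definition nbhd_adj G r v : rel (nbhd_vertex G r v) :=
  fun x y => adj G (val x) (val y).

Definition nbhd_root G r v : nbhd_vertex G r v := exist _ v (ball_center G r v).

End Graph.

Definition rooted_iso (T U : Type) (e : rel T) (x : T) (f : rel U) (y : U)
    : Prop :=
  exists phi : T -> U,
    [/\ bijective phi, forall a b, f (phi a) (phi b) = e a b & phi x = y].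

Definition nbhd_iso (V : finType) (G : sgraph V) (r : nat) (u v : V) : Prop :=
  rooted_iso (@nbhd_adj V G r u) (nbhd_root G r u)
             (@nbhd_adj V G r v) (nbhd_root G r v).

Section ErdosRenyi.
Variables (R : realType) (n : nat) (p : R).

(** The vertex set [{1, ..., n}] is represented by ['I_n]. *)
Definition gnp_mass (G : sgraph 'I_n) : R :=
  \prod_(e : vpair 'I_n) (if e \in G then p else 1 - p).

Definition gnp_prob (A : set (sgraph 'I_n)) : R :=
  \sum_(G : sgraph 'I_n | G \in A) gnp_mass G.

Lemma gnp_probT : gnp_prob setT = 1.
Proof.
rewrite /gnp_prob (eq_bigl xpredT) => [|G]; last by rewrite in_setT.
transitivity (\prod_(e : vpair 'I_n) (p + (1 - p))).
  by rewrite bigA_distr.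
by rewrite big1 // => e _; rewrite addrC subrK.
Qed.

End ErdosRenyi.

(* Main.v *)
(** With [d = n p], [L = ln n] and [l = ln L], call a vertex good if its
    [2]-neighbourhood is a tree, its degree is at most [L^3], and the degrees of
    its neighbours lie within [W = L / (10 l)] of [d].  A first moment estimate
    for short cycles, Markov's inequality and a Chernoff bound show that a vertex
    is bad with probability [O(1 / l)], so with high probability more than half
    of the vertices are good.  The [2]-neighbourhood of a good vertex is
    determined by the number of its neighbours of each degree, for which there
    are at most [(L^3 + 1) ^ (2 W + 2) <= n / 2] possibilities; two good vertices
    therefore share a [2]-neighbourhood. *)
Require Import Defs.
From mathcomp Require Import all_boot all_order all_algebra.
From mathcomp Require Import all_classical all_reals all_analysis.
From mathcomp Require Import finset.
From mathcomp Require Import ring lra.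

Set Implicit Arguments.
Unset Strict Implicit.
Unset Printing Implicit Defensive.

Import Order.TTheory GRing.Theory Num.Theory.
Import numFieldNormedType.Exports.

Local Open Scope ring_scope.

(** * Neighbourhoods of radius two that are trees, and their isomorphism *)

Section RootedTree.
Local Open Scope nat_scope.
Variables (V : finType) (G : sgraph V).
Implicit Types (u v w x y : V) (k : nat).

Definition nbrs v : {set V} := [set w | adj G v w].

Definition deg v : nat := #|nbrs v|.

Lemma adj_sym v w : adj G v w = adj G w v.
Proof. by apply: eq_existsb => e; rewrite [X in _ == X]setUC. Qed.

Lemma adj_irr v : adj G v v = false.
Proof.
apply/existsP => -[e /andP[_ /eqP E]].
by have := valP e; rewrite /= E setUid cards1.
Qed.

Lemma adj_neq v w : adj G v w -> v != w.
Proof. by move=> vw; apply: contraTneq vw => ->; rewrite adj_irr. Qed.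

(** Index [0] denotes [v] and index [i.+1] the [i]-th entry of [t]. *)
Definition pattern v k (es : seq (nat * nat)) : bool :=
  [exists t : k.-tuple V, uniq (v :: t) &&
    all (fun ij => adj G (nth v (v :: t) ij.1) (nth v (v :: t) ij.2)) es].

(** Up to isomorphism, the ways in which the [2]-neighbourhood of [v] (index [0])
    can fail to be a tree. *)
Definition cycle3 := [:: (0, 1); (0, 2); (1, 2)].
Definition cycle4 := [:: (0, 1); (1, 2); (2, 3); (0, 3)].
Definition paw := [:: (0, 1); (1, 2); (1, 3); (2, 3)].
Definition cycle5 := [:: (0, 1); (1, 2); (2, 3); (3, 4); (0, 4)].

Definition treelike v : bool :=
  [&& ~~ pattern v 2 cycle3, ~~ pattern v 3 cycle4,
      ~~ pattern v 3 paw & ~~ pattern v 4 cycle5].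

Section Treelike.
Variable v : V.
Hypothesis tv : treelike v.

Lemma treelike_nbrs w w' : adj G v w -> adj G v w' -> adj G w w' = false.
Proof.
move=> vw vw'; apply: contraTF tv => ww'; rewrite /treelike negb_and negbK.
apply/orP; left; apply/existsP; exists [tuple w; w'].
by rewrite /= !inE vw vw' ww' negb_or !adj_neq.
Qed.

(** Otherwise [v], [w], [x], [w'] would form a [cycle4]. *)
Lemma treelike_parent w w' x :
  adj G v w -> adj G v w' -> adj G w x -> adj G w' x -> x != v -> w = w'.
Proof.
move=> vw vw' wx w'x xv; apply: contraTeq tv => ww'.
rewrite /treelike !negb_and !negbK.
apply/orP; right; apply/orP; left; apply/existsP; exists [tuple w; x; w'].
rewrite /= !inE vw vw' wx (adj_sym x) w'x !negb_or ww'.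
by rewrite (adj_neq vw) (adj_neq vw') (adj_neq wx) [x == w']eq_sym (adj_neq w'x)
  [v == x]eq_sym xv.
Qed.

(** An edge between two grandchildren closes a [paw] if they share a parent and a [cycle5] if they
    do not. The degenerate coincidences [x = w'] and [x' = w] must be excluded first; they would put
    a triangle at [v]. *)
Lemma treelike_children w w' x x' :
  adj G v w -> adj G v w' -> adj G w x -> adj G w' x' -> x != v -> x' != v ->
  adj G x x' = false.
Proof.
move=> vw vw' wx w'x' xv x'v; apply/idP => xx'.
have xw' : x != w'.
  by apply: contraTneq wx => ->; rewrite (treelike_nbrs vw vw').
have x'w : x' != w.
  by apply: contraTneq w'x' => ->; rewrite (treelike_nbrs vw' vw).
move: tv; apply/negP; rewrite /treelike !negb_and !negbK.
have [eww'|ww'] := eqVneq w w'.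
  apply/orP; right; apply/orP; right; apply/orP; left; apply/existsP.
  exists [tuple w; x; x']; rewrite -eww' in w'x'.
  rewrite /= !inE vw wx w'x' xx' !negb_or (adj_neq vw) (adj_neq wx).
  by rewrite (adj_neq w'x') (adj_neq xx') [v == x]eq_sym xv [v == x']eq_sym x'v.
apply/orP; right; apply/orP; right; apply/orP; right; apply/existsP.
exists [tuple w; x; x'; w'].
rewrite /= !inE vw wx xx' vw' (adj_sym x') w'x' !negb_or (adj_neq vw).
rewrite (adj_neq wx) (adj_neq xx') [v == x]eq_sym xv [v == x']eq_sym x'v.
by rewrite (adj_neq vw') [w == x']eq_sym x'w ww' xw' eq_sym (adj_neq w'x').
Qed.

End Treelike.

Lemma ball2P v w :
  reflect [\/ w = v, adj G v w | exists2 x, adj G v x & adj G x w]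
          (w \in Defs.ball G 2 v).
Proof.
rewrite inE; apply: (iffP existsP) => [[[k ltk3] /existsP[s /andP[]]]|].
  case: k ltk3 s => [|[|[|//]]] ltk3 [] s /=.
  - by move=> /eqP/size0nil -> _ /eqP <-; constructor 1.
  - case: s => [//|a []//] _ /=; rewrite andbT => va /eqP <-.
    by constructor 2.
  - case: s => [//|a [//|b []//]] _ /=; rewrite andbT => /andP[va ab] /eqP <-.
    by constructor 3; exists a.
case=> [->|vw|[x vx xw]].
- exists ord0; apply/existsP; exists [tuple] => /=; exact: eqxx.
- exists (@Ordinal 3 1 isT); apply/existsP; exists [tuple w].
  by rewrite /= vw eqxx.
- exists (@Ordinal 3 2 isT); apply/existsP; exists [tuple x; w].
  by rewrite /= vx xw eqxx.
Qed.

(** Sorting by degree makes the list of degrees canonical: vertices whose neighbours have the same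
    multiset of degrees get the same list, hence the same codes. *)
Definition sorted_nbrs v : seq V := sort (relpre deg leq) (enum (nbrs v)).

(** Codes for the vertices of a rooted tree of height two: [(0, 0)] is the root,
    [(i.+1, 0)] the [i]-th child of the root and [(i.+1, j.+1)] the [j]-th child
    of the latter. *)
Definition decode v (c : nat * nat) : V :=
  if c.1 is i.+1 then
    let w := nth v (sorted_nbrs v) i in
    if c.2 is j.+1 then nth v (enum (nbrs w :\ v)) j else w
  else v.

(** The second index ranges below the degree itself: a child of degree [k] has [k - 1] children
    besides the root, and index [0] is taken by the child. *)
Definition code_dom (ds : seq nat) (c : nat * nat) : bool :=
  if c.1 is i.+1 then (i < size ds) && (c.2 < nth 0 ds i) else c.2 == 0.

Definition code_adj (c c' : nat * nat) : bool :=
  match c, c' with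
  | (0, _), (0, _) => false
  | (0, _), (_.+1, j) | (_.+1, j), (0, _) => j == 0
  | (i.+1, j), (i'.+1, j') => (i == i') && ((j == 0) != (j' == 0))
  end.

Lemma mem_sorted_nbrs v w : (w \in sorted_nbrs v) = adj G v w.
Proof. by rewrite mem_sort mem_enum inE. Qed.

Lemma sorted_nbrs_uniq v : uniq (sorted_nbrs v).
Proof. by rewrite sort_uniq enum_uniq. Qed.

Lemma size_children v w : adj G v w -> size (enum (nbrs w :\ v)) = (deg w).-1.
Proof.
move=> vw; rewrite -cardE /deg (cardsD1 v (nbrs w)).
by rewrite inE adj_sym vw add1n.
Qed.

Lemma deg_gt0 v w : adj G v w -> 0 < deg w.
Proof.
by move=> vw; apply/card_gt0P; exists v; rewrite inE adj_sym.
Qed.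

(** A case principle by level: it replaces the index bounds by the adjacencies that the arguments
    about [decode] use. *)
Lemma code_domP v (P : nat * nat -> Prop) :
    P (0, 0) ->
    (forall i, i < size (sorted_nbrs v) ->
      adj G v (nth v (sorted_nbrs v) i) -> P (i.+1, 0)) ->
    (forall i j, i < size (sorted_nbrs v) ->
      adj G v (nth v (sorted_nbrs v) i) ->
      j < size (enum (nbrs (nth v (sorted_nbrs v) i) :\ v)) ->
      adj G (nth v (sorted_nbrs v) i) (decode v (i.+1, j.+1)) ->
      decode v (i.+1, j.+1) != v -> P (i.+1, j.+1)) ->
  forall c, code_dom (map deg (sorted_nbrs v)) c -> P c.
Proof.
move=> P0 P1 P2 [[|i] j]; rewrite /code_dom /=; first by move=> /eqP ->.
rewrite size_map => /andP[ltis]; rewrite (nth_map v) //.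
have vw : adj G v (nth v (sorted_nbrs v) i) by rewrite -mem_sorted_nbrs mem_nth.
case: j => [|j] ltj; first exact: P1.
have ltj' : j < size (enum (nbrs (nth v (sorted_nbrs v) i) :\ v)).
  by rewrite size_children // -ltnS prednK // (leq_trans _ ltj).
have := mem_nth v ltj'; rewrite mem_enum !inE => /andP[? ?].
exact: P2.
Qed.

(** Since [code_adj] does not mention [G], the codes are a model common to all treelike vertices
    with the same degree list. The nine cases compare levels; each unwanted edge would create one of
    the forbidden patterns. *)
Lemma decode_adj v c c' : treelike v ->
    code_dom (map deg (sorted_nbrs v)) c ->
    code_dom (map deg (sorted_nbrs v)) c' ->
  adj G (decode v c) (decode v c') = code_adj c c'.
Proof.
move=> tv; move: c; apply: code_domP => [|i lti vw|i j lti vw ltj wx xv];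
  move: c'; apply: code_domP => [|i' lti' vw'|i' j' lti' vw' ltj' wx' xv'] /=.
- by rewrite adj_irr.
- by [].
- apply: contraTF wx' => vx'.
  by rewrite (treelike_nbrs tv vw' vx').
- by rewrite adj_sym.
- by rewrite (treelike_nbrs tv vw vw') andbF.
- have [->|ii'] := eqVneq i i'; first exact: wx'.
  apply: contraNF ii' => wx.
  have /eqP := treelike_parent tv vw vw' wx wx' xv'.
  by rewrite nth_uniq // sorted_nbrs_uniq.
- apply: contraTF wx => xv1; rewrite adj_sym in xv1.
  by rewrite (treelike_nbrs tv vw xv1).
- rewrite adj_sym; have [<-|ii'] := eqVneq i i'; first exact: wx.
  apply: contraNF ii' => wx'.
  have /eqP := treelike_parent tv vw vw' wx wx' xv.
  by rewrite nth_uniq // sorted_nbrs_uniq.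
- by rewrite andbF (treelike_children tv vw vw' wx wx').
Qed.

(** A vertex on two different levels would give a loop, a triangle at [v], or [v] as its own
    grandchild. A grandchild determines its parent by [treelike_parent], and then its position among
    the children. *)
Lemma decode_inj v : treelike v ->
  {in code_dom (map deg (sorted_nbrs v)) &, injective (decode v)}.
Proof.
move=> tv c c'; rewrite !unfold_in; move: c.
apply: code_domP => [|i lti vw|i j lti vw ltj wx xv];
  move: c'; apply: code_domP => [|i' lti' vw'|i' j' lti' vw' ltj' wx' xv'] //.
- by rewrite /decode /= => e; rewrite -e adj_irr in vw'.
- by move=> e; rewrite -e eqxx in xv'.
- by rewrite /decode /= => e; rewrite e adj_irr in vw.
- rewrite /decode /= => /eqP; rewrite nth_uniq ?sorted_nbrs_uniq //.
  by move=> /eqP ->.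
- by move=> e; move: wx'; rewrite -e (treelike_nbrs tv vw' vw).
- by move=> e; rewrite e eqxx in xv.
- by move=> e; move: wx; rewrite e (treelike_nbrs tv vw vw').
- move=> e; rewrite -e in wx'; have /eqP := treelike_parent tv vw vw' wx wx' xv.
  rewrite nth_uniq ?sorted_nbrs_uniq // => /eqP ii'; rewrite -ii' in e ltj' *.
  move: e; rewrite /decode /= => /eqP; rewrite nth_uniq ?enum_uniq //.
  by move=> /eqP ->.
Qed.

Lemma decode_ball v w : treelike v ->
  (w \in Defs.ball G 2 v) <->
  exists2 c, code_dom (map deg (sorted_nbrs v)) c & decode v c = w.
Proof.
move=> tv; split; last first.
  move=> [c + <-]; move: c; apply: code_domP => [|i _ vw|i j _ vw _ wx _];
    apply/ball2P.
  - by constructor 1.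
  - by constructor 2.
  - by constructor 3; exists (nth v (sorted_nbrs v) i).
move=> /ball2P[->|vw|[x vx xw]]; first by exists (0, 0).
  have ws : w \in sorted_nbrs v by rewrite mem_sorted_nbrs.
  exists ((index w (sorted_nbrs v)).+1, 0); last by rewrite /decode /= nth_index.
  rewrite /code_dom /= size_map index_mem ws (nth_map v) ?index_mem //.
  by rewrite nth_index // (deg_gt0 vw).
have [->|wv] := eqVneq w v; first by exists (0, 0).
have xs : x \in sorted_nbrs v by rewrite mem_sorted_nbrs.
have wc : w \in enum (nbrs x :\ v) by rewrite mem_enum !inE wv.
exists ((index x (sorted_nbrs v)).+1, (index w (enum (nbrs x :\ v))).+1); last first.
  by rewrite /decode /= !nth_index.
rewrite /code_dom /= size_map index_mem xs (nth_map v) ?index_mem //.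
rewrite nth_index //=.
by rewrite -[deg x]prednK ?(deg_gt0 vx) // ltnS -(size_children vx) index_mem.
Qed.

(** Equal multiplicities make the two lists permutations of each other, and sorted permutations
    coincide. *)
Lemma same_degrees u v :
    (forall k, #|[set w in nbrs u | deg w == k]| =
               #|[set w in nbrs v | deg w == k]|) ->
  map deg (sorted_nbrs u) = map deg (sorted_nbrs v).
Proof.
move=> H; apply: (@sorted_eq _ leq).
- exact: leq_trans.
- exact: anti_leq.
- by rewrite sorted_map; apply: sort_sorted => x y; exact: leq_total.
- by rewrite sorted_map; apply: sort_sorted => x y; exact: leq_total.
have E x k : count_mem k (map deg (sorted_nbrs x)) =
             #|[set w in nbrs x | deg w == k]|.
  rewrite count_map; have /permP -> :=
    permEl (perm_sort (relpre deg leq) (enum (nbrs x))).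
  rewrite -size_filter cardE /enum_mem -filter_predI; congr size.
  by apply: eq_filter => w; rewrite !inE andbC.
by apply/allP => k _ /=; rewrite !E H.
Qed.

(** The isomorphism reads off a code at [u] and decodes it at [v]; the inverse is the same
    construction with the roles exchanged. *)
Lemma treelike_iso u v : treelike u -> treelike v ->
    (forall k, #|[set w in nbrs u | deg w == k]| =
               #|[set w in nbrs v | deg w == k]|) ->
  nbhd_iso G 2 u v.
Proof.
move=> tu tv /same_degrees eds.
have duv x (tx : treelike x) (a : nbhd_vertex G 2 x) :
    exists c, code_dom (map deg (sorted_nbrs x)) c && (decode x c == val a).
  have /(decode_ball _ tx)[c cd e] := valP a.
  by exists c; rewrite cd e eqxx.
pose f x y (tx : treelike x) (a : nbhd_vertex G 2 x) : V :=
  decode y (xchoose (duv x tx a)).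
have fP x y (tx : treelike x) (ty : treelike y)
    (e : map deg (sorted_nbrs x) = map deg (sorted_nbrs y)) a :
    f x y tx a \in Defs.ball G 2 y.
  apply/decode_ball => //; exists (xchoose (duv x tx a)) => //.
  by rewrite -e; have /andP[] := xchooseP (duv x tx a).
pose g x y tx ty e a : nbhd_vertex G 2 y := exist _ (f x y tx a) (fP x y tx ty e a).
have gK x y (tx : treelike x) (ty : treelike y) e e' :
    cancel (g x y tx ty e) (g y x ty tx e').
  move=> a; apply/val_inj; rewrite /= /f.
  have /andP[d1 /eqP e1] := xchooseP (duv x tx a).
  have /andP[d2 /eqP e2] := xchooseP (duv y ty (g x y tx ty e a)).
  (* The code chosen for the image need not a priori be the one chosen for [a]; injectivity of
     decoding identifies them. *)
  apply: etrans e1; congr decode; apply: (decode_inj ty) => //.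
  by rewrite unfold_in -e.
exists (g u v tu tv eds); split.
- by exists (g v u tv tu (esym eds)); exact: gK.
- move=> a b; rewrite /nbhd_adj /= /f.
  have /andP[d1 /eqP e1] := xchooseP (duv u tu a).
  have /andP[d2 /eqP e2] := xchooseP (duv u tu b).
  by rewrite (decode_adj tv) -?eds // -(decode_adj tu) // e1 e2.
- apply/val_inj => /=; rewrite /f.
  have /andP[d1 /eqP e1] := xchooseP (duv u tu (nbhd_root G 2 u)).
  have -> : xchoose (duv u tu (nbhd_root G 2 u)) = (0, 0) by exact: (decode_inj tu).
  by [].
Qed.

End RootedTree.

(** * Edges at a vertex and degrees *)

Lemma card2P (V : finType) (e : vpair V) (w : V) :
  w \in val e -> exists2 x, x != w & val e = [set w; x].
Proof.
move=> we; have /cards2P[a [b [ab E]]] := valP e.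
move: we; rewrite E !inE => /orP[] /eqP ->.
  by exists b => //; rewrite eq_sym.
by exists a => //; rewrite setUC.
Qed.

(** The edge is fixed before [G], so adjacency becomes a single coordinate of the product
    measure. *)
Lemma adj_edge (V : finType) (v w : V) : v != w ->
  exists2 e : vpair V, val e = [set v; w] & forall G, adj G v w = (e \in G).
Proof.
move=> vw; have e2 : #|[set v; w]| == 2%N by rewrite cards2 vw.
pose e0 : vpair V := Sub [set v; w] e2; exists e0 => [//|G].
apply/existsP/idP => [[e /andP[eG /eqP E]]|eG]; last by exists e0; rewrite eG /=.
by rewrite (_ : e0 = e) //; exact/val_inj.
Qed.

Definition star (V : finType) (w : V) : {set vpair V} := [set e : vpair V | w \in val e].

(** Removing [w] from an edge at [w] leaves the singleton of a neighbour, which matches edges with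
    neighbours. *)
Lemma degE (V : finType) (G : sgraph V) (w : V) : deg G w = #|G :&: star w|.
Proof.
have injl : {in G :&: star w &, injective (fun e => val e :\ w)}.
  move=> e e'; rewrite !inE => /andP[_ we] /andP[_ we'] E.
  by apply/val_inj; rewrite -(setD1K we) E setD1K.
rewrite -(card_in_imset injl) /deg -(card_imset (nbrs G w) set1_inj).
apply: eq_card => A; apply/imsetP/imsetP => [[x xw ->]|[e]].
  rewrite inE in xw; have /existsP[e /andP[eG /eqP E]] := xw.
  exists e; first by rewrite !inE eG E !inE eqxx.
  by rewrite E setU1K // inE (adj_neq xw).
rewrite !inE => /andP[eG we] ->; have [x xw E] := card2P we.
exists x; last by rewrite E setU1K // inE eq_sym.
by rewrite inE; apply/existsP; exists e; rewrite eG E eqxx.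
Qed.

Lemma card_star n (w : 'I_n) : #|star w| = n.-1.
Proof.
have := degE [set: vpair 'I_n] w; rewrite setTI => <-.
rewrite /deg (_ : nbrs _ _ = [set~ w]) ?cardsC1 ?card_ord //.
apply/setP => x; rewrite !inE; apply/idP/idP => [/adj_neq|xw].
  by rewrite eq_sym.
have [|e _ ->] := @adj_edge _ w x; first by rewrite eq_sym.
by rewrite inE.
Qed.

(** * Expectations in the random graph, and independence of edges *)

Section Expectation.
Variables (R : realType) (n : nat) (p : R).
Hypothesis p01 : 0 <= p <= 1.
Implicit Types (G : sgraph 'I_n) (X Y : sgraph 'I_n -> R) (v w : 'I_n).

Definition gnp_E X : R := \sum_G gnp_mass p G * X G.

Lemma gnp_mass_ge0 G : 0 <= gnp_mass p G.
Proof.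
by have /andP[? ?] := p01; apply: prodr_ge0 => e _; case: ifP; rewrite ?subr_ge0.
Qed.

Lemma gnp_E_le X Y : (forall G, X G <= Y G) -> gnp_E X <= gnp_E Y.
Proof. by move=> XY; apply: ler_sum => G _; rewrite ler_wpM2l ?gnp_mass_ge0. Qed.

Lemma gnp_E_sum (I : finType) (P : pred I) (X : I -> sgraph 'I_n -> R) :
  gnp_E (fun G => \sum_(i | P i) X i G) = \sum_(i | P i) gnp_E (X i).
Proof. by rewrite exchange_big; apply: eq_bigr => G _; rewrite mulr_sumr. Qed.

Lemma gnp_ED X Y : gnp_E (fun G => X G + Y G) = gnp_E X + gnp_E Y.
Proof. by rewrite -big_split; apply: eq_bigr => G _; rewrite mulrDr. Qed.

Lemma gnp_EZ c X : gnp_E (fun G => c * X G) = c * gnp_E X.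
Proof. by rewrite mulr_sumr; apply: eq_bigr => G _; rewrite mulrCA. Qed.

Lemma gnp_probE (b : pred (sgraph 'I_n)) :
  gnp_prob p [set G | b G]%classic = gnp_E (fun G => (b G)%:R).
Proof.
rewrite /gnp_prob big_mkcond; apply: eq_bigr => G _.
rewrite (_ : G \in _ = b G); last by apply/idP/idP; rewrite in_setE.
by case: (b G); rewrite ?mulr1 ?mulr0.
Qed.

Lemma gnp_prob_le (A B : classical_sets.set (sgraph 'I_n)) :
  (A `<=` B)%classic -> gnp_prob p A <= gnp_prob p B.
Proof.
move=> AB; rewrite /gnp_prob [leLHS]big_mkcond [leRHS]big_mkcond.
apply: ler_sum => G _; case: ifPn => [|_]; last by case: ifP; rewrite ?gnp_mass_ge0.
by rewrite in_setE => /AB AG; rewrite ifT // in_setE.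
Qed.

(** Independence of the edges: expanding the product of two-term sums yields one term per graph. *)
Lemma gnp_E_prod (f : vpair 'I_n -> bool -> R) :
  gnp_E (fun G => \prod_e f e (e \in G)) =
  \prod_e (p * f e true + (1 - p) * f e false).
Proof.
rewrite bigA_distr; apply: eq_big => // G _; rewrite -big_split.
by apply: eq_bigr => e _ /=; case: (e \in G).
Qed.

Lemma gnp_E_edges (S : {set vpair 'I_n}) :
  gnp_E (fun G => (S \subset G)%:R) = p ^+ #|S|.
Proof.
transitivity (gnp_E (fun G => \prod_e if e \in S then (e \in G)%:R else 1)).
  apply: eq_bigr => G _; congr (_ * _); rewrite -big_mkcond.
  have [/fintype.subsetP SG|/subsetPn[e eS eG]] := boolP (S \subset G).
    by rewrite big1 // => e /SG ->.
  by rewrite (bigD1 e) //= (negPf eG) mul0r.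
rewrite (gnp_E_prod (fun e b => if e \in S then b%:R else 1)) -prodr_const.
rewrite [RHS]big_mkcond; apply: eq_bigr => e _.
by case: ifP; rewrite ?mulr1 ?mulr0 ?addr0 // addrC subrK.
Qed.

Lemma gnp_E_adj v w : v != w -> gnp_E (fun G => (adj G v w)%:R) = p.
Proof.
move=> /adj_edge[e _ adjE]; have := gnp_E_edges [set e]; rewrite cards1 expr1 => <-.
by apply: eq_bigr => G _; rewrite adjE sub1set.
Qed.

(** Union bound over the [n ^ k] placements of the other vertices; a placement without repetition
    requires [size es] distinct edges. *)
Lemma gnp_E_pattern v k (es : seq (nat * nat)) :
    uniq es -> all (fun ij => ij.1 < ij.2 < k.+1)%N es ->
  gnp_E (fun G => (pattern G v k es)%:R) <= n%:R ^+ k * p ^+ size es.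
Proof.
move=> ues les; have /andP[p0 _] := p01.
pose ev (t : k.-tuple 'I_n) G := uniq (v :: t) &&
  all (fun ij => adj G (nth v (v :: t) ij.1) (nth v (v :: t) ij.2)) es.
apply: (@le_trans _ _ (\sum_(t : k.-tuple 'I_n) gnp_E (fun G => (ev t G)%:R))).
  rewrite -gnp_E_sum; apply: gnp_E_le => G.
  have [/existsP[t evt]|_] := boolP (pattern G v k es); last exact: sumr_ge0.
  by rewrite (bigD1 t) //= [ev t G]evt lerDl sumr_ge0.
apply: (@le_trans _ _ (\sum_(t : k.-tuple 'I_n) p ^+ size es)); last first.
  by rewrite sumr_const card_tuple card_ord -natrX mulr_natl.
apply: ler_sum => t _.
have [ut|nut] := boolP (uniq (v :: t)); last first.
  rewrite (_ : gnp_E _ = 0) ?exprn_ge0 // /gnp_E big1 // => G _.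
  by rewrite /ev (negPf nut) mulr0.
have tz i : (i < k.+1)%N -> (i < size (v :: t))%N by rewrite /= size_tuple.
pose edge (ij : nat * nat) := [set nth v (v :: t) ij.1; nth v (v :: t) ij.2].
have edge2 ij : ij \in es -> #|edge ij| == 2%N.
  move=> /(allP les)/andP[lt1 lt2].
  by rewrite cards2 nth_uniq ?tz ?(ltn_trans lt1) ?(ltn_eqF lt1).
(* Writing each index pair in increasing order excludes the crossed identification of endpoints. *)
have edge_inj : {in es &, injective edge}.
  move=> ij kl ijes kles E.
  have /andP[lt1 lt2] := allP les _ ijes; have /andP[lt3 lt4] := allP les _ kles.
  have lt1' := ltn_trans lt1 lt2; have lt3' := ltn_trans lt3 lt4.
  have : nth v (v :: t) ij.1 \in edge kl by rewrite -E !inE eqxx.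
  have : nth v (v :: t) ij.2 \in edge kl by rewrite -E !inE eqxx orbT.
  rewrite !inE !nth_uniq ?tz //.
  case: ij kl lt1 lt2 lt3 lt4 {E ijes kles lt1' lt3'} => [a b] [c d] /=.
  move=> ab _ cd _ /orP[]/eqP E1 /orP[]/eqP E2; move: ab cd; rewrite E1 E2.
  - by rewrite ltnn.
  - by move=> /ltn_trans H /H; rewrite ltnn.
  - by [].
  - by rewrite ltnn.
pose S : {set vpair 'I_n} := [set e : vpair 'I_n | val e \in map edge es].
have <- : #|S| = size es.
  rewrite -(size_map edge) -(card_uniqP _) ?map_inj_in_uniq //.
  rewrite -(card_imset S val_inj); apply: eq_card => A.
  apply/imsetP/idP => [[e + ->]|Aes]; first by rewrite inE.
  have A2 : #|A| == 2%N by have /mapP[ij ijes ->] := Aes; exact: edge2.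
  by pose e0 : vpair 'I_n := Sub A A2; exists e0; rewrite ?inE.
rewrite -gnp_E_edges; apply: gnp_E_le => G.
rewrite /ev ut /= ler_nat.
have [/allP Gt|//] := boolP (all _ _).
suff -> : S \subset G by [].
apply/fintype.subsetP => e; rewrite inE => /mapP[ij /Gt/existsP[e' /andP[e'G /eqP E']] E].
by rewrite (_ : e = e') //; apply/val_inj; rewrite E' E.
Qed.

(** The edge [vw] must be present and contributes [p * expR s]; each of the other [n - 2] pairs at
    [w] contributes its moment generating function. *)
Lemma gnp_E_star s v w : v != w ->
  gnp_E (fun G => (adj G v w)%:R * expR (s * (deg G w)%:R)) =
  p * expR s * (p * expR s + (1 - p)) ^+ n.-2.
Proof.
move=> vw; have [e0 E0 adjE] := adj_edge vw.
have e0w : e0 \in star w by rewrite inE E0 !inE eqxx orbT.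
pose f (e : vpair 'I_n) (b : bool) : R :=
  if e \in star w then
    (if e == e0 then b%:R else 1) * (if b then expR s else 1)
  else 1.
transitivity (gnp_E (fun G => \prod_e f e (e \in G))).
  apply: eq_bigr => G _; congr (_ * _); rewrite adjE degE -big_mkcond big_split /=.
  congr (_ * _).
    by rewrite -big_mkcondr /= (big_pred1 e0) // => e /=; rewrite andbC; case: eqP => // ->.
  rewrite -big_mkcondr /= prodr_const mulrC expRM_natl; congr (_ ^+ _).
  by apply: eq_card => e; rewrite [RHS]unfold_in !inE andbC.
rewrite gnp_E_prod (bigD1 e0) //= {1 2}/f e0w eqxx /= mul0r mulr0 addr0 mul1r.
congr (_ * _); rewrite (bigID (mem (star w))) /= [X in _ * X]big1 ?mulr1; last first.
  by move=> e /andP[_ /negPf ew]; rewrite /f ew !mulr1 addrC subrK.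
rewrite (eq_bigr (fun=> p * expR s + (1 - p))); last first.
  by move=> e /andP[/negPf ee0 ew]; rewrite /f ew ee0 !mul1r mulr1.
rewrite prodr_const; congr (_ ^+ _).
have := card_star w; rewrite (cardsD1 e0) e0w add1n => /(congr1 predn) /= <-.
by apply: eq_card => e; rewrite [LHS]unfold_in !inE.
Qed.

End Expectation.


(** * Chernoff bound for the degree of a neighbour *)

Section Deviation.
Variables (R : realType) (n : nat) (p : R).
Hypothesis p01 : 0 <= p <= 1.
Local Notation d := (n%:R * p).
Implicit Types (G : sgraph 'I_n) (v w : 'I_n).

(** Squaring [1 - s / 2 <= expR (- s / 2)] bounds [expR (- s)] from below, and [(1 + s + s ^+ 2) *
    (1 - s / 2) ^+ 2 = 1 + s ^+ 2 / 4 * (1 - 3 * s + s ^+ 2)], which is at least [1] in this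
    range. *)
Lemma expR_quadratic (s : R) : `|s| <= 1 / 4 -> expR s <= 1 + s + s ^+ 2.
Proof.
rewrite ler_norml => /andP[s1 s2].
have h : (1 - s / 2) ^+ 2 <= expR (- s).
  rewrite (_ : - s = 2%:R * (- (s / 2))) ?expRM_natl; last by field.
  rewrite lerXn2r ?nnegrE ?expR_ge0 //; first lra.
  exact: expR_ge1Dx.
have h1 : expR s * expR (- s) = 1 by rewrite -expRD subrr expR0.
have h2 : expR s * (1 - s / 2) ^+ 2 <= 1.
  by rewrite -[leRHS]h1 ler_wpM2l ?expR_ge0.
have h3 : 1 <= (1 + s + s ^+ 2) * (1 - s / 2) ^+ 2 by nra.
have pos : 0 < (1 - s / 2) ^+ 2 by rewrite exprn_gt0 //; lra.
by rewrite -(ler_pM2r pos) (le_trans h2 h3).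
Qed.

(** The term [3 * |s|] absorbs the conditioning on the edge [vw] (one [s]) and the linear terms of
    the two factors missing from [n] ([- 2 * p * s]). *)
Lemma gnp_E_tilt (s : R) v w : v != w -> `|s| <= 1 / 4 ->
  gnp_E p (fun G => (adj G v w)%:R * expR (s * ((deg G w)%:R - d))) <=
  p * expR (3 * `|s| + d * s ^+ 2).
Proof.
move=> vw s1; have /andP[p0 p1] := p01.
have n2 : (2 <= n)%N.
  case: n v w vw {s1} => [|[|//]]; first by case.
  by move=> v w; rewrite !ord1 eqxx.
have En : (n.-2)%:R = n%:R - 2 :> R by rewrite -subn2 natrB.
under eq_fun => G.
  rewrite mulrBr expRD mulrA mulrC.
  over.
rewrite gnp_EZ gnp_E_star //.
rewrite (_ : _ * _ = p * (expR (s - s * d) * (p * expR s + (1 - p)) ^+ n.-2)); last first.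
  by rewrite expRD; ring.
rewrite ler_wpM2l //.
have base : p * expR s + (1 - p) <= expR (p * (s + s ^+ 2)).
  apply: le_trans (expR_ge1Dx _).
  have := ler_wpM2l p0 (expR_quadratic s1).
  by rewrite !mulrDr mulr1; lra.
have base0 : 0 <= p * expR s + (1 - p).
  by rewrite addr_ge0 ?subr_ge0 // mulr_ge0 ?expR_ge0.
have := lerXn2r n.-2 base0 (expR_ge0 _) base.
rewrite -expRM_natl => /(ler_wpM2l (expR_ge0 (s - s * d))) H.
apply: le_trans H _.
rewrite -expRD ler_expR En.
have a1 : s <= `|s| := ler_norm s.
have a2 : - (p * s) <= `|s|.
  by rewrite -mulrN (le_trans _ (ler_piMl (normr_ge0 s) p1)) //
    ler_wpM2l // -normrN ler_norm.
have a3 : 0 <= p * s ^+ 2 by rewrite mulr_ge0 ?sqr_ge0.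
nra.
Qed.

(** Exponential Markov inequality with tilts [t] and [- t], one for each tail; hence the factor
    [2]. *)
Lemma gnp_E_deviation (t W : R) v w : v != w -> 0 <= t <= 1 / 4 ->
  gnp_E p (fun G => (adj G v w && ~~ (`|(deg G w)%:R - d| <= W))%:R) <=
  2 * p * expR (3 * t + d * t ^+ 2 - t * W).
Proof.
move=> vw /andP[t0 t1].
have tn : `|t| <= 1 / 4 by rewrite ger0_norm.
have tn' : `|- t| <= 1 / 4 by rewrite normrN.
pose X s G := (adj G v w)%:R * expR (s * ((deg G w)%:R - d)).
apply: (@le_trans _ _ (gnp_E p (fun G => expR (- (t * W)) * (X t G + X (- t) G)))).
  apply: gnp_E_le => // G; rewrite /X.
  case: (adj G v w); last by rewrite !mul0r addr0 mulr0.
  rewrite !mul1r /= -ltNge; case: ltP => [|_]; last first.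
    by rewrite mulr_ge0 ?addr_ge0 ?expR_ge0.
  set y := _ - d => Wy; rewrite mulrDr -!expRD.
  have e0 z : 0 <= expR z :> R := expR_ge0 z.
  have [y0|y0] := lerP 0 y.
    rewrite ger0_norm // in Wy.
    apply: (@le_trans _ _ (expR (- (t * W) + t * y))); last by rewrite lerDl.
    by rewrite -expR0 ler_expR -subr_ge0 subr0 addrC -mulrBr mulr_ge0 // subr_ge0 ltW.
  rewrite ltr0_norm // in Wy.
  apply: (@le_trans _ _ (expR (- (t * W) + - t * y))); last by rewrite lerDr.
  by rewrite -expR0 ler_expR mulNr -mulrN addrC -mulrBr mulr_ge0 // subr_ge0 ltW.
rewrite gnp_EZ gnp_ED.
have h1 := gnp_E_tilt vw tn; have h2 := gnp_E_tilt vw tn'.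
rewrite normrN sqrrN in h2; rewrite ger0_norm // in h1 h2.
have := ler_wpM2l (expR_ge0 (- (t * W))) (lerD h1 h2).
move=> H; apply: le_trans H _; rewrite [in leRHS]expRD.
by rewrite le_eqVlt; apply/orP; left; apply/eqP; ring.
Qed.

End Deviation.

(** * Counting bad vertices and the pigeonhole argument *)

Section Collision.
Variables (R : realType) (n : nat) (p : R) (B m : nat) (W t : R).
Hypothesis p01 : 0 <= p <= 1.
Local Notation d := (n%:R * p).
Implicit Types (G : sgraph 'I_n) (u v w : 'I_n).

Definition good G v : bool :=
  [&& treelike G v, (deg G v <= B)%N &
      [forall w, adj G v w ==> (`|(deg G w)%:R - d| <= W)]].

(** The summands bound the expected numbers of non-tree patterns at [v], the
    probability that [deg v > B] (Markov) and the expected number of neighbours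
    of [v] whose degree deviates by more than [W] (Chernoff, with tilt [t]). *)
Definition bad_bound : R :=
  d ^+ 2 * p + 2 * (d ^+ 3 * p) + d ^+ 4 * p + d / B.+1%:R
  + 2 * d * expR (3 * t + d * t ^+ 2 - t * W).

Lemma gnp_E_bad v : 0 <= t <= 1 / 4 ->
  gnp_E p (fun G => (~~ good G v)%:R) <= bad_bound.
Proof.
move=> t01; have /andP[p0 p1] := p01.
pose dev w G := adj G v w && ~~ (`|(deg G w)%:R - d| <= W).
pose X G : R := (pattern G v 2 cycle3)%:R + (pattern G v 3 cycle4)%:R
  + (pattern G v 3 paw)%:R + (pattern G v 4 cycle5)%:R
  + B.+1%:R^-1 * (\sum_(w | v != w) (adj G v w)%:R) + \sum_(w | v != w) (dev w G)%:R.
apply: (@le_trans _ _ (gnp_E p X)).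
  apply: gnp_E_le => // G; rewrite /good /treelike !negb_and !negbK /X.
  have s0 : 0 <= \sum_(w | v != w) (dev w G)%:R :> R by apply: sumr_ge0.
  have Ed : \sum_(w | v != w) (adj G v w)%:R = (deg G v)%:R :> R.
    rewrite -natr_sum; congr (_%:R); rewrite /deg -sum1_card big_mkcond [RHS]big_mkcond.
    apply: eq_bigr => w _; rewrite inE.
    by case: eqVneq => [<-|_]; rewrite ?adj_irr //; case: (adj _ _ _).
  have d0 : 0 <= B.+1%:R^-1 * (deg G v)%:R :> R by rewrite mulr_ge0 ?invr_ge0.
  (* Union bound: one summand dominating the indicator suffices, the others being nonnegative. *)
  have key (x a b c e f g : R) : 0 <= a -> 0 <= b -> 0 <= c -> 0 <= e -> 0 <= f ->
      0 <= g -> [\/ x <= a, x <= b, x <= c | x <= e \/ x <= f \/ x <= g] ->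
      x <= a + b + c + e + f + g.
    by move=> ? ? ? ? ? ? [||| [|[|]]]; lra.
  rewrite Ed; apply: key => //.
  case: (pattern G v 2 cycle3) => /=; first by constructor 1.
  case: (pattern G v 3 cycle4) => /=; first by constructor 2.
  case: (pattern G v 3 paw) => /=; first by constructor 3.
  case: (pattern G v 4 cycle5) => /=; first by constructor 4; left.
  constructor 4; right; rewrite -ltnNge.
  have [Bd|_] /= := ltnP B (deg G v).
    by left; rewrite mulrC ler_pdivlMr ?ltr0n // mul1r ler_nat.
  right; rewrite negb_forall; case: existsP => [[w]|_] //.
  rewrite negb_imply => devw; have vw : v != w by case/andP: devw => /adj_neq.
  rewrite (bigD1 w) //= [dev w G]devw lerDl.
  exact: sumr_ge0.
have cardn : \sum_(w | v != w) 1 <= n%:R :> R.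
  rewrite sumr_const -[n in leRHS](card_ord n) ler_nat.
  by apply: max_card.
rewrite !gnp_ED gnp_EZ !gnp_E_sum /bad_bound.
(* Each pattern has [k] vertices besides [v] and [k + 1] edges, so its bound [n ^ k * p ^ (k + 1)]
   is [d ^ k * p]. *)
have h3 : gnp_E p (fun G => (pattern G v 2 cycle3)%:R) <= n%:R ^+ 2 * p ^+ 3.
  exact: gnp_E_pattern.
have h4 : gnp_E p (fun G => (pattern G v 3 cycle4)%:R) <= n%:R ^+ 3 * p ^+ 4.
  exact: gnp_E_pattern.
have hp : gnp_E p (fun G => (pattern G v 3 paw)%:R) <= n%:R ^+ 3 * p ^+ 4.
  exact: gnp_E_pattern.
have h5 : gnp_E p (fun G => (pattern G v 4 cycle5)%:R) <= n%:R ^+ 4 * p ^+ 5.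
  exact: gnp_E_pattern.
have hB : B.+1%:R^-1 * (\sum_(w | v != w) gnp_E p (fun G => (adj G v w)%:R)) <=
    d / B.+1%:R.
  rewrite mulrC ler_wpM2r ?invr_ge0 // (eq_bigr (fun=> 1 * p)); last first.
    by move=> w vw; rewrite mul1r gnp_E_adj.
  by rewrite -mulr_suml ler_wpM2r.
have hd : \sum_(w | v != w) gnp_E p (fun G => (dev w G)%:R) <=
    2 * d * expR (3 * t + d * t ^+ 2 - t * W).
  apply: (@le_trans _ _ (\sum_(w | v != w)
    1 * (2 * p * expR (3 * t + d * t ^+ 2 - t * W)))).
    by apply: ler_sum => w vw; rewrite mul1r; exact: gnp_E_deviation.
  rewrite -mulr_suml (_ : 2 * d * _ =
    n%:R * (2 * p * expR (3 * t + d * t ^+ 2 - t * W))); last by ring.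
  by rewrite ler_wpM2r // !mulr_ge0 ?expR_ge0.
rewrite (_ : _ * _ = d ^+ 2 * p) in h3; last by ring.
rewrite (_ : _ * _ = d ^+ 3 * p) in h4; last by ring.
rewrite (_ : _ * _ = d ^+ 3 * p) in hp; last by ring.
rewrite (_ : _ * _ = d ^+ 4 * p) in h5; last by ring.
by rewrite [2 * (_ * p)]mulr_natl mulr2n addrA !lerD.
Qed.

Lemma window (x : R) (k : nat) : 0 <= W -> 2 * W + 1 < m%:R -> `|k%:R - x| <= W ->
  (Num.truncn (x - W) <= k < Num.truncn (x - W) + m)%N.
Proof.
move=> W0 Wm; rewrite ler_norml => /andP[h1 h2].
(* If [x < W], truncation gives [0] and the window starts there; it still suffices because
   [k <= x + W < 2 * W < m]. *)
have [x0|x0] := lerP 0 (x - W).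
  have /andP[t1 t2] := truncn_itv x0.
  apply/andP; split.
    by rewrite -(ler_nat R); lra.
  by rewrite -(ltr_nat R) natrD; rewrite -natr1 in t2; lra.
rewrite (_ : Num.truncn _ = 0%N) ?leq0n ?add0n /=; last first.
  by apply/truncn0Pn; rewrite -ltNge; lra.
by rewrite -(ltr_nat R); lra.
Qed.

(** Pigeonhole: a type records how many neighbours have each degree in the window, and good vertices
    have no neighbour of any other degree. *)
Lemma good_collision G : 0 <= W -> 2 * W + 1 < m%:R ->
    (B.+1 ^ m < #|[set v | good G v]|)%N ->
  exists u v, u <> v /\ nbhd_iso G 2 u v.
Proof.
move=> W0 Wm big; set a := Num.truncn (d - W).
pose cnt v k := #|[set w in nbrs G v | deg G w == k]|.
(* [inord] sends values above [B] to [0]; the counts at a good vertex are at most its degree, hence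
   at most [B], so nothing is lost. *)
pose type v : {ffun 'I_m -> 'I_B.+1} := [ffun i : 'I_m => inord (cnt v (a + i)%N)].
have /dinjectivePn : ~~ dinjectiveb type [set v | good G v].
  apply: contraL big => /dinjectiveP /card_in_image E.
  rewrite -leqNgt -E (leq_trans (max_card _)) //.
  by rewrite card_ffun !card_ord.
move=> [u gu [v]]; rewrite !inE in gu *.
move=> /andP[vu gv] euv; exists u, v; split.
  by move/eqP: vu; apply: contra_not => ->.
have /and3P[tu du /forallP wu] := gu; have /and3P[tv dv /forallP wv] := gv.
have cle x k : good G x -> (cnt x k < B.+1)%N.
  move=> /and3P[_ dx _]; rewrite ltnS (leq_trans _ dx) //.
  by apply: subset_leq_card; apply/fintype.subsetP => w; rewrite inE => /andP[].
have c0 x k : good G x -> ~~ (a <= k < a + m)%N -> cnt x k = 0%N.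
  move=> /and3P[_ _ /forallP wx]; apply: contraNeq.
  rewrite -lt0n => /card_gt0P[w]; rewrite !inE => /andP[xw /eqP <-].
  by apply: window => //; exact: (implyP (wx w)).
apply: treelike_iso => // k; rewrite -/(cnt u k) -/(cnt v k).
have [/andP[ak kam]|nk] := boolP (a <= k < a + m)%N; last by rewrite !c0.
have kam' : (k - a < m)%N by rewrite ltn_subLR.
move/ffunP: euv => /(_ (Ordinal kam')); rewrite !ffunE /= subnKC //.
by move=> /(congr1 val); rewrite /= !inordK ?cle.
Qed.

Lemma gnp_prob_collision : 0 <= W -> 2 * W + 1 < m%:R -> 0 <= t <= 1 / 4 ->
    (0 < n)%N -> (2 * B.+1 ^ m <= n)%N ->
  1 - 2 * bad_bound <=
    gnp_prob p [set G | exists u v : 'I_n, u <> v /\ nbhd_iso G 2 u v]%classic <= 1.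
Proof.
move=> W0 Wm t01 n0 types.
have E1 : gnp_E p (fun _ : sgraph 'I_n => 1) = 1.
  rewrite -[RHS](gnp_probT n p); apply: eq_big => [G|G _]; last by rewrite mulr1.
  by rewrite classical_sets.in_setT.
apply/andP; split; last first.
  by rewrite -(gnp_probT n p); apply: gnp_prob_le.
pose bG G := (n < 2 * #|[set v | good G v]|)%N.
apply: (@le_trans _ _ (gnp_prob p [set G | bG G]%classic)); last first.
  apply: gnp_prob_le => // G /= bg; apply: good_collision => //.
  by rewrite -(ltn_pmul2l (isT : 0 < 2)%N) (leq_ltn_trans types).
rewrite gnp_probE.
have n0' : 0 < n%:R :> R by rewrite ltr0n.
(* Markov's inequality in linear form: [Y] is at most [1], and at most [0] once half of the vertices
   are bad, so it lies below the indicator of [bG]. *)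
pose Y G : R := 1 + (- (2 / n%:R)) * \sum_v (~~ good G v)%:R.
apply: (@le_trans _ _ (gnp_E p Y)).
  rewrite gnp_ED E1 gnp_EZ gnp_E_sum mulNr lerB //.
  rewrite (le_trans (ler_wpM2l _ (ler_sum _ (fun v _ => gnp_E_bad v t01)))) ?divr_ge0 //.
  rewrite sumr_const card_ord -[_ *+ n]mulr_natr le_eqVlt; apply/orP; left; apply/eqP.
  by field; rewrite gt_eqF.
apply: gnp_E_le => // G; rewrite /Y /bG.
have Eb : \sum_v (~~ good G v)%:R = n%:R - #|[set v | good G v]|%:R :> R.
  have := cardsC [set v | good G v]; rewrite card_ord => /(congr1 (fun k => k%:R : R)).
  rewrite natrD => <-; rewrite addrC addKr.
  rewrite -natr_sum -sum1_card big_mkcond [X in _ = X%:R]big_mkcond.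
  congr (_%:R); apply: eq_bigr => v _; rewrite !inE.
  by case: (good G v).
rewrite Eb; set c := #|_|.
have [_|le] := ltnP; rewrite mulNr.
  rewrite lerBlDr lerDl mulr_ge0 ?divr_ge0 // subr_ge0.
  by rewrite ler_nat; have := max_card [set v | good G v]; rewrite card_ord.
rewrite subr_le0 mulrAC ler_pdivlMr // mul1r.
by move: le; rewrite -(ler_nat R) natrM; lra.
Qed.

End Collision.

(** * Choice of parameters and numerical estimates *)

Section Asymptotics.
Variable R : realType.

Lemma expR_ge_cube (l : R) : 0 <= l -> (l / 3) ^+ 3 <= expR l.
Proof.
move=> l0; rewrite [in leRHS](_ : l = 3%:R * (l / 3)); last by field.
rewrite expRM_natl lerXn2r ?nnegrE ?expR_ge0 ?divr_ge0 //.
by apply: le_trans (expR_ge1Dx _); rewrite lerDr.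
Qed.

Lemma gnp_prob_iso (n : nat) (p : R) (L := ln n%:R : R) (l := ln L) :
    0 <= p <= 1 -> 18 ^+ 3 <= l -> n%:R * p <= L ^+ 2 / (10 * l) ^+ 3 ->
  1 - 14 / l <=
    gnp_prob p [set G | exists u v : 'I_n, u <> v /\ nbhd_iso G 2 u v]%classic <= 1.
Proof.
move=> p01 lK dle; have /andP[p0 p1] := p01.
have l0 : 0 < l by lra.
have L0 : 0 < L.
  by rewrite ltNge; apply/negP => /ln0 L0; move: l0; rewrite /l L0 ltxx.
have n0 : 0 < n%:R :> R.
  by rewrite ltNge; apply/negP => /ln0 E; move: L0; rewrite /L E ltxx.
have EL : expR l = L by rewrite lnK.
have En : expR L = n%:R by rewrite lnK.
(* This amounts to [t <= 1 / 4] for the tilt [t] below. As [l >= 18 ^+ 3], the cube bound gives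
   [L >= l ^+ 3 / 27 >= 216 * l ^+ 2]. *)
have Lbig : 160 * l ^+ 2 <= L.
  rewrite -EL; apply: le_trans (expR_ge_cube (ltW l0)); rewrite exprMn exprS.
  have : 0 <= l ^+ 2 by rewrite sqr_ge0.
  nra.
have l5 : 5 <= l by lra.
clear lK; clearbody L l.
have lL : 5 + 40 * l <= L by nra.
set d := n%:R * p in dle.
have d0 : 0 <= d by rewrite mulr_ge0.
(* [W] is small enough for the types to number at most [n / 2], and [t] makes
   the Chernoff exponent [d * t ^+ 2 - t * W] at most [- 2.4 * l]. *)
pose W := L / (10 * l); pose t := 40 * l ^+ 2 / L.
pose B := Num.truncn (L ^+ 3); pose m := (Num.truncn (2 * W + 1)).+1.
have W0 : 0 <= W by rewrite divr_ge0 ?mulr_ge0 ?ltW.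
have L30 : 0 <= L ^+ 3 by rewrite exprn_ge0 ?ltW.
have /andP[B1 B2] := truncn_itv L30.
have W10 : 0 <= 2 * W + 1 by lra.
have /andP[m1 m2] := truncn_itv W10.
have t01 : 0 <= t <= 1 / 4.
  apply/andP; split; first by rewrite divr_ge0 ?mulr_ge0 ?sqr_ge0 ?ltW.
  rewrite /t ler_pdivrMr //; lra.
clear Lbig.
(* On the logarithmic scale: [2] costs at most [1], each factor [B + 1 <= L ^ 4] costs [4 * l], and
   [m <= 2 * W + 2]. The total [1 + 4 / 5 * L + 8 * l] is at most [L] exactly by [lL]. *)
have types : (2 * B.+1 ^ m <= n)%N.
  rewrite -(ler_nat R) natrM natrX -En.
  have B0 : 0 <= B.+1%:R :> R by [].
  have BL : B.+1%:R <= expR (4 * l) :> R.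
    rewrite expRM_natl EL -natr1 exprS.
    have : 1 <= L ^+ 3 by rewrite exprn_ege1 //; lra.
    rewrite -/B in B1 *; nra.
  have := lerXn2r m B0 (expR_ge0 _) BL; rewrite -expRM_natl => H.
  have e2 : 2 <= expR 1 :> R by have := expR_ge1Dx (1 : R); lra.
  apply: (@le_trans _ _ (expR 1 * expR (m%:R * (4 * l)))); first exact: ler_pM.
  rewrite -expRD ler_expR.
  have mW : m%:R <= 2 * W + 2 by rewrite /m -natr1; lra.
  have : m%:R * (4 * l) <= (2 * W + 2) * (4 * l) by rewrite ler_wpM2r //; lra.
  have -> : (2 * W + 2) * (4 * l) = 4 / 5 * L + 8 * l by rewrite /W; field; lra.
  lra.
have n1 : (0 < n)%N by rewrite -(ltr_nat R).
have /andP[lo ->] := gnp_prob_collision p01 W0 m2 t01 n1 types.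
rewrite andbT; apply: le_trans lo; rewrite lerB //.
(* Counted with coefficients, [bad_bound] has [1 + 2 + 1 + 1 + 2 = 7] terms, each at most
   [1 / l]. *)
suff : bad_bound n p B W t <= 7 / l by move=> H; lra.
rewrite /bad_bound -/d.
have L1 : 1 <= L by lra.
have l1 : 1 <= l by lra.
have l3 : 1 <= (10 * l) ^+ 3 by rewrite exprn_ege1 //; lra.
have dL : d <= L ^+ 2.
  apply: le_trans dle _; rewrite ler_pdivrMr ?(lt_le_trans ltr01) //.
  by rewrite ler_peMr ?sqr_ge0.
have Ll : L^-1 <= l^-1 by rewrite lef_pV2 ?posrE //; lra.
have pE : p = d / n%:R by rewrite /d mulrC mulKf ?gt_eqF.
(* Here [d ^ k * p = d ^ (k + 1) / n <= L ^ 10 / n], and [L ^ 11 = expR (11 * l) <= expR L = n]. *)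
have cyc k : (k <= 4)%N -> d ^+ k * p <= l^-1.
  move=> k4; apply: le_trans Ll; rewrite pE mulrA -exprSr ler_pdivrMr //.
  rewrite ler_pdivlMl // -En.
  apply: (@le_trans _ _ (L * (L ^+ 2) ^+ k.+1)).
    by rewrite ler_wpM2l ?(ltW L0) // lerXn2r ?nnegrE ?sqr_ge0.
  rewrite -exprM -exprS.
  apply: (@le_trans _ _ (L ^+ 11)).
    by rewrite ler_weXn2l //; exact: (@leq_mul 2 k.+1 2 5).
  rewrite -[in leLHS]EL -expRM_natl ler_expR; lra.
have c2 := cyc 2%N isT; have c3 := cyc 3%N isT; have c4 := cyc 4%N isT.
have cB : d / B.+1%:R <= l^-1.
  apply: le_trans Ll; rewrite ler_pdivrMr // ler_pdivlMl //.
  apply: le_trans (ltW B2); rewrite exprS.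
  by rewrite ler_wpM2l ?(ltW L0).
have ct : d * expR (3 * t + d * t ^+ 2 - t * W) <= l^-1.
  have dt : d * t ^+ 2 <= 16 / 10 * l.
    rewrite (le_trans (ler_wpM2r (sqr_ge0 _) dle)) // le_eqVlt; apply/orP; left.
    by apply/eqP; rewrite /t; field; rewrite !gt_eqF.
  have tW : t * W = 4 * l by rewrite /t /W; field; rewrite !gt_eqF.
  (* The exponent is at most [3 / 4 + 1.6 * l - 4 * l], and [l >= 5] absorbs the constant. The
     resulting [L ^ (-2)] cancels the [L ^ 2] in the bound on [d]. *)
  have : expR (3 * t + d * t ^+ 2 - t * W) <= expR (- (2%:R * l)).
    by rewrite ler_expR tW; lra.
  rewrite expRN expRM_natl EL => /(ler_wpM2l d0) H; apply: le_trans H _.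
  rewrite ler_pdivrMr ?exprn_gt0 // mulrC (le_trans dle) // ler_wpM2l ?sqr_ge0 //.
  rewrite lef_pV2 ?posrE ?(lt_le_trans ltr01) //.
  apply: (@le_trans _ _ (10 * l)); first lra.
  by rewrite exprS ler_peMr ?exprn_ege1 //; lra.
move: c2 c3 c4 cB ct; rewrite -[2 * d * _]mulrA.
move: (_ * p) (_ * p) (_ * p) (d / _) (d * expR _) => a b c e f; lra.
Qed.

End Asymptotics.

(** * Passage to the limit *)

Local Open Scope classical_set_scope.
Local Open Scope ring_scope.

Theorem theorem1 (R : realType) (p : nat -> R)
    (p01 : forall n : nat, (1 <= n)%N -> 0 <= p n <= 1)
    (p_small : (fun n : nat => n%:R * p n : R) =o_\oo
               (fun n : nat => ln (n%:R) ^+ 2 / ln (ln (n%:R)) ^+ 3 : R)) :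
  gnp_prob (p n)
    [set G : sgraph 'I_n | exists u v : 'I_n, u <> v /\ nbhd_iso G 2 u v]
    @[n --> \oo] --> (1 : R).
Proof.
have lnln (M : R) : \forall n \near \oo, M <= ln (ln (n%:R : R)).
  near=> n; rewrite -ler_expR lnK; last first.
    rewrite posrE ln_gt0 //; near: n; exact: nbhs_infty_gtr.
  rewrite -ler_expR lnK; last first.
    by rewrite posrE; near: n; exact: nbhs_infty_gtr.
  by near: n; exact: nbhs_infty_ger.
have small (c : R) : 0 < c -> \forall n \near \oo, `|n%:R * p n| <=
    c * `|ln (n%:R : R) ^+ 2 / ln (ln (n%:R : R)) ^+ 3|.
  by have /eqoP := p_small; apply.
(* The little-o hypothesis is applied with this one constant, which produces the denominator
   [(10 * l) ^+ 3]. *)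
have c0 : 0 < (10 ^+ 3)^-1 :> R by rewrite invr_gt0 exprn_gt0.
apply/cvgrPdist_le => e e0; near=> n.
have n1 : (1 <= n)%N by near: n; exact: nbhs_infty_ge.
have lK : 18 ^+ 3 <= ln (ln (n%:R : R)) by near: n; exact: lnln.
have le : 14 / e <= ln (ln (n%:R : R)) by near: n; exact: lnln.
have l0 : 0 < ln (ln (n%:R : R)) by apply: lt_le_trans lK; rewrite exprn_gt0.
have dle : n%:R * p n <= ln (n%:R) ^+ 2 / (10 * ln (ln (n%:R))) ^+ 3.
  have H : `|n%:R * p n| <= (10 ^+ 3)^-1 *
      `|ln (n%:R : R) ^+ 2 / ln (ln (n%:R : R)) ^+ 3|.
    by near: n; exact: small.
  apply: le_trans (ler_norm _) (le_trans H _).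
  rewrite ger0_norm; first by rewrite mulrCA -invfM -exprMn.
  by apply: divr_ge0; rewrite ?sqr_ge0 ?exprn_ge0 ?(ltW l0).
have /andP[lo hi] := gnp_prob_iso (p01 n n1) lK dle.
rewrite ger0_norm ?subr_ge0 // lerBlDr -lerBlDl; apply: le_trans lo.
apply: lerB => //.
by rewrite ler_pdivrMr // mulrC -ler_pdivrMr.
Unshelve. all: by end_near.
Qed.
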